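(* For any integer $n > 1$, the number $$a_n = \frac{1}{2n^3(n-1)} \sum_{k=0}^{n-1} (3k^2+k)\,D_k\, 16^{n-1-k}$$ is an integer. Moreover, $a_n$ is odd if and only if $n$ is a power of two. Also, for any prime $p>3$ we have the supercongruence $$\sum_{k=0}^{p-1}\frac{3k^2+k}{16^k}D_k\equiv-4p^4q_p(2)\pmod{p^5}.$$
   Context: The Domb numbers are $D_k:=\sum_{l=0}^k\binom{k}{l}^2\binom{2l}{l}\binom{2(k-l)}{k-l}$ for $k=0,1,2,\ldots$. For an odd prime $p$, $q_p(2)$ denotes the Fermat quotient $(2^{p-1}-1)/p$. Congruences modulo $p^5$ between rational numbers with denominators prime to $p$ mean that the difference divided by $p^5$ is a rational number with denominator prime to $p$. *)

(* Defs.v *)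
From mathcomp Require Import all_boot all_order all_algebra.

Set Implicit Arguments.
Unset Strict Implicit.
Unset Printing Implicit Defensive.

Import GRing.Theory Num.Theory.
Local Open Scope ring_scope.

Definition domb (k : nat) : nat :=
  (\sum_(l < k.+1) 'C(k, l) ^ 2 * 'C(2 * l, l) * 'C(2 * (k - l), k - l))%N.

Definition domb_quotient (n : nat) : rat :=
  1 / (2 * n%:R ^+ 3 * (n%:R - 1)) *
  \sum_(k < n) (3 * k%:R ^+ 2 + k%:R) * (domb k)%:R * 16 ^+ (n - 1 - k).

Definition fermat_quotient (p a : nat) : rat := (a%:R ^+ (p - 1) - 1) / p%:R.

Definition p_integral (p : nat) (x : rat) : bool := coprime p `|denq x|%N.

(* Congruence modulo p ^ e in the rationals with denominator prime to p. *)
Definition rat_eqmod (p e : nat) (x y : rat) : bool :=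
  p_integral p ((x - y) / p%:R ^+ e).

(* Main.v *)
(** The sum telescopes: applying the adjoint of the Domb recurrence
    (k+1)^3 D_(k+1) = 2 (2k+1) (5k^2+5k+2) D_k - 64 k^3 D_(k-1)  to the weights
    16^-k gives a multiple of (3k^2+k) 16^-k, whence
      6 sum_(k<n) (3k^2+k) D_k 16^(n-1-k) = n^3 (D_n - 4 D_(n-1)).
    The single-sum formula D_n = sum_k C(n+k,3k) C(2k,k)^2 C(3k,k) 4^(n-2k),
    proved because both sides satisfy this recurrence, turns D_n - 4 D_(n-1)
    into 12 (n-1) times an explicit sum of natural numbers, which is a_n.  All
    its terms are even except possibly the one with n = 2k, which is odd iff
    k is a power of two.  For n = p every term is p times an integer and
    a_p / p = sum_(1<=k<=h) C(2k,k)^2 / (2 k 16^k) = - H_h = 2 q_p(2) mod p,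
    where h = (p-1)/2 and H_h is the harmonic number. *)
Require Import Defs.
From mathcomp Require Import all_boot all_order all_algebra.
From mathcomp Require Import cyclic.
From mathcomp Require Import ring lra zify.
Import Order.TTheory GRing.Theory Num.Theory.
Local Open Scope ring_scope.

(** * Binomial coefficients as quotients of factorials *)

Lemma fact_neq0 (n : nat) : n`!%:R != 0 :> rat.
Proof. by rewrite pnatr_eq0 -lt0n fact_gt0. Qed.

Lemma bin_ratE (m n : nat) : 'C(m + n, m)%:R = (m + n)`!%:R / (m`!%:R * n`!%:R) :> rat.
Proof.
have /(congr1 (fun x : nat => x%:R : rat)) := bin_fact (leq_addr n m).
rewrite addKn !natrM => <-.
by rewrite mulfK // mulf_neq0 ?fact_neq0.
Qed.

(** * The recurrence of the Domb numbers *)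

(** D_n / n!^2 is the convolution of this sequence with itself, since C(n,i) = n! / (i! (n-i)!). *)
Definition half_domb (i : nat) : rat := 'C(2 * i, i)%:R / i`!%:R ^+ 2.

Lemma half_dombE i : half_domb i = (2 * i)`!%:R / i`!%:R ^+ 4.
Proof.
rewrite /half_domb mul2n -addnn bin_ratE; have := fact_neq0 i => ?.
by field.
Qed.

Lemma half_domb_rec i :
  i.+1%:R ^+ 3 * half_domb i.+1 = 2 * (2 * i%:R + 1) * half_domb i.
Proof.
rewrite !half_dombE; have -> : (2 * i.+1 = (2 * i).+2)%N by lia.
rewrite !factS !natrM.
have := fact_neq0 i; have : i.+1%:R != 0 :> rat by rewrite pnatr_eq0.
rewrite -!natr1 natrM => ? ?; field; exact/andP.
Qed.

(** The weight takes both indices as rationals x and y, so that weights may be compared as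
    polynomials under x + y = n. *)
Definition conv (P : rat -> rat -> rat) (n : nat) : rat :=
  \sum_(i < n.+1) P i%:R (n - i)%:R * (half_domb i * half_domb (n - i)).

Lemma domb_conv n : (domb n)%:R = n`!%:R ^+ 2 * conv (fun _ _ => 1) n :> rat.
Proof.
rewrite /domb /conv natr_sum mulr_sumr; apply: eq_bigr => i _.
have lein : (i <= n)%N by rewrite -ltnS.
rewrite !natrM /half_domb.
have /(congr1 (fun x : nat => x%:R : rat)) := bin_fact lein.
rewrite !natrM => <-.
have := fact_neq0 i; have := fact_neq0 (n - i) => ? ?; field; exact/andP.
Qed.

Lemma eq_conv P Q n : (forall x y, x + y = n%:R -> P x y = Q x y) -> conv P n = conv Q n.
Proof.
move=> PQ; apply: eq_bigr => i _; congr (_ * _); apply: PQ.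
by rewrite -natrD subnKC // -ltnS.
Qed.

Lemma conv_sym P n : conv P n = conv (fun x y => P y x) n.
Proof.
rewrite /conv (reindex_inj rev_ord_inj) /=; apply: eq_bigr => i _.
have lein : (i <= n)%N by rewrite -ltnS.
rewrite subSS subKn //; congr (_ * _); exact: mulrC.
Qed.

Lemma convD P Q n : conv (fun x y => P x y + Q x y) n = conv P n + conv Q n.
Proof. by rewrite /conv -big_split /=; apply: eq_bigr => i _; rewrite mulrDl. Qed.

Lemma convZ c P n : conv (fun x y => c * P x y) n = c * conv P n.
Proof. by rewrite /conv mulr_sumr; apply: eq_bigr => i _; rewrite !mulrA. Qed.

Lemma conv_symmetrize P n : 2 * conv P n = conv (fun x y => P x y + P y x) n.
Proof. rewrite convD -(conv_sym P); ring. Qed.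

(** The factor x^3 kills the term x = 0 and pays for [half_domb_rec] in all others, which lowers the
    total index by one. *)
Lemma conv_shift P n :
  conv (fun x y => x ^+ 3 * P x y) n.+1 =
  conv (fun x y => 2 * (2 * x + 1) * P (x + 1) y) n.
Proof.
rewrite /conv big_ord_recl /= expr0n /= !mul0r add0r; apply: eq_bigr => i _.
rewrite /bump /= add1n subSS natr1.
have := half_domb_rec i.
set a := half_domb i.+1; set b := half_domb i => E.
transitivity (i.+1%:R ^+ 3 * a * half_domb (n - i) * P i.+1%:R (n - i)%:R); first by ring.
by rewrite E; ring.
Qed.

Lemma conv1_rec n :
  n.+2%:R ^+ 5 * conv (fun _ _ => 1) n.+2 =
  2 * (2 * n%:R + 3) * (5 * n%:R ^+ 2 + 15 * n%:R + 12) * conv (fun _ _ => 1) n.+1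
  - 64 * n.+1%:R * conv (fun _ _ => 1) n.
Proof.
(* Every monomial of (x + y)^5 is divisible by x^3 or by y^3, so symmetry and
   conv_shift lower n; the same happens to what remains at n.+1. *)
pose A (x y : rat) := x ^+ 2 + 5 * x * y + 10 * y ^+ 2.
have -> : n.+2%:R ^+ 5 * conv (fun _ _ => 1) n.+2 =
          conv (fun x y => 4 * (2 * x + 1) * A (x + 1) y) n.+1.
  transitivity (2 * conv (fun x y => x ^+ 3 * A x y) n.+2).
    rewrite conv_symmetrize -convZ; apply: eq_conv => x y <-; rewrite /A; ring.
  rewrite conv_shift -convZ; apply: eq_conv => x y _; ring.
apply/eqP; rewrite -subr_eq0 opprB addrA addrAC; apply/eqP.
pose B (x y : rat) := 2 * (2 * (x + y) + 1) * (5 * (x + y) ^+ 2 + 5 * (x + y) + 2).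
have -> : 2 * (2 * n%:R + 3) * (5 * n%:R ^+ 2 + 15 * n%:R + 12) * conv (fun _ _ => 1) n.+1
        = conv B n.+1.
  rewrite -convZ; apply: eq_conv => x y; rewrite /B => ->; rewrite -(natr1 n); ring.
have -> : conv (fun x y => 4 * (2 * x + 1) * A (x + 1) y) n.+1 = 
   conv B n.+1 + (-16) * (2 * conv (fun x y => x ^+ 3 * 1) n.+1).
  (* [C] is antisymmetric in x and y, so its convolution vanishes. *)
  pose C (x y : rat) :=
    4 * (2 * x + 1) * A (x + 1) y + (-1) * B x y + 32 * (x ^+ 3 * 1).
  suff E : conv C n.+1 = 0.
    move: E; rewrite /C !convD !convZ; lra.
  have : 2 * conv C n.+1 = 0.
    rewrite conv_symmetrize (@eq_conv _ (fun x y => 0 * 1)) ?convZ ?mul0r // => x y _.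
    rewrite /C /A /B; ring.
  lra.
rewrite conv_shift.
have -> : conv (fun x y => 2 * (2 * x + 1) * 1) n = 2 * n.+1%:R * conv (fun _ _ => 1) n.
  have : 2 * conv (fun x y => 2 * (2 * x + 1) * 1) n = 2 * (2 * n.+1%:R * conv (fun _ _ => 1) n).
    rewrite conv_symmetrize -!convZ; apply: eq_conv => x y; rewrite -(natr1 n) => <-; ring.
  lra.
ring.
Qed.

Lemma domb_rec n :
  n.+2%:R ^+ 3 * (domb n.+2)%:R =
  2 * (2 * n%:R + 3) * (5 * n%:R ^+ 2 + 15 * n%:R + 12) * (domb n.+1)%:R
  - 64 * n.+1%:R ^+ 3 * (domb n)%:R :> rat.
Proof.
rewrite !domb_conv !factS !natrM.
have := conv1_rec n.
set a := conv _ _; set b := conv _ _; set c := conv _ _; set f := n`!%:R => E.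
transitivity (n.+1%:R ^+ 2 * f ^+ 2 * (n.+2%:R ^+ 5 * a)); first ring.
by rewrite E; ring.
Qed.

(** * The single-sum formula, by creative telescoping *)

(** The truncated n - 2k is harmless: the first binomial vanishes for n < 2k. *)
Definition rogers_term (n k : nat) : nat :=
  ('C(n + k, 3 * k) * 'C(2 * k, k) ^ 2 * 'C(3 * k, k) * 4 ^ (n - 2 * k))%N.

Lemma rogers_term0 n k : (n < 2 * k)%N -> rogers_term n k = 0%N.
Proof. by move=> lt_nk; rewrite /rogers_term bin_small //; lia. Qed.

Lemma bin3_ratE k : 'C(3 * k, k)%:R = (3 * k)`!%:R / (k`!%:R * (2 * k)`!%:R) :> rat.
Proof. by rewrite (_ : 3 * k = k + 2 * k)%N ?bin_ratE //; lia. Qed.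

Lemma bin2_ratE k : 'C(2 * k, k)%:R = (2 * k)`!%:R / (k`!%:R * k`!%:R) :> rat.
Proof. by rewrite (_ : 2 * k = k + k)%N ?bin_ratE //; lia. Qed.

Lemma rogers_termE r k :
  (rogers_term (2 * k + r) k)%:R =
  (r + 3 * k)`!%:R * (2 * k)`!%:R * 4 ^+ r / (r`!%:R * k`!%:R ^+ 5) :> rat.
Proof.
rewrite /rogers_term addKn (_ : 2 * k + r + k = 3 * k + r)%N; last by lia.
rewrite !natrM !natrX bin3_ratE bin2_ratE bin_ratE [(r + _)%N]addnC.
have := fact_neq0 r; have := fact_neq0 k; have := fact_neq0 (2 * k); have := fact_neq0 (3 * k).
move=> *; field; apply/and4P; split=> //.
Qed.

(* The certificate of Zeilberger's algorithm, up to the factor -192 (3n + 4);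
   the explicit 0 stands for the inverse factorial of a negative integer. *)
Definition rogers_cert (n k : nat) : rat :=
  if (n.+2 < 2 * k)%N then 0 else
  (n + k)`!%:R * (2 * k)`!%:R * 4 ^+ (n.+2 - 2 * k) / 16
    / ((n.+2 - 2 * k)`!%:R * k`!%:R ^+ 5) * k%:R ^+ 4.

Lemma rogers_certE n k :
  n.+2%:R ^+ 3 * (rogers_term n.+2 k)%:R
  - 2 * (2 * n%:R + 3) * (5 * n%:R ^+ 2 + 15 * n%:R + 12) * (rogers_term n.+1 k)%:R
  + 64 * n.+1%:R ^+ 3 * (rogers_term n k)%:R =
  - 192 * (3 * n%:R + 4) * (rogers_cert n k.+1 - rogers_cert n k).
Proof.
have [lt_nk|] := ltnP n.+2 (2 * k).
  rewrite !rogers_term0 /rogers_cert ?ifT //; try lia.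
  ring.
move/subnKC; set r := (n.+2 - 2 * k)%N => En.
have := fact_neq0 k; have := fact_neq0 (2 * k) => f2 fk.
have k1 : k.+1%:R != 0 :> rat by rewrite pnatr_eq0.
rewrite /rogers_cert -En (_ : (2 * k + r < 2 * k)%N = false) ?addKn; last by lia.
(* For r = 0 the terms at n and n + 1 vanish, for r = 1 only the one at n; in both cases the
   certificate at k + 1 is the default 0. From r = 2 on every factorial is genuine. *)
case: r En => [|[|r]] En.
- have nE : n%:R = 2 * k%:R - 2 :> rat.
    have : n.+2%:R = 2 * k%:R :> rat by rewrite -natrM; congr (_%:R); lia.
    rewrite -(natr1 n.+1) -(natr1 n); lra.
  have -> : (n + k = (3 * k).-2)%N by lia.
  rewrite (@rogers_term0 n) ?(@rogers_term0 n.+1) ?rogers_termE; try lia.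
  rewrite ifT; last by lia.
  have -> : (2 * k + 0)%:R = 2 * k%:R :> rat by rewrite addn0 natrM.
  have -> : n.+1%:R = 2 * k%:R - 1 :> rat by rewrite -(natr1 n) nE; ring.
  rewrite nE.
  have k0 : (0 < k)%N by lia.
  case: k k0 {En nE f2 k1} fk => // k _; have -> : (3 * k.+1 = (3 * k).+3)%N by lia.
  have -> : (2 * k.+1 = (2 * k).+2)%N by lia.
  rewrite /= add0n !factS !natrM mulf_eq0 negb_or => /andP[k1 fk].
  by field; rewrite nat1r k1 fk.
- have nE : n%:R = 2 * k%:R - 1 :> rat.
    by rewrite -natrM (_ : 2 * k = n.+1)%N -?(natr1 n) ?addrK //; lia.
  have -> : (n + k = (3 * k).-1)%N by lia.
  have E1 : (n.+1 = 2 * k + 0)%N by lia.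
  rewrite (@rogers_term0 n) ?E1 ?rogers_termE; try lia.
  rewrite ifT; last by lia.
  rewrite nE.
  have k0 : (0 < k)%N by lia.
  case: k k0 {En nE f2 E1 k1} fk => // k _; have -> : (3 * k.+1 = (3 * k).+3)%N by lia.
  have -> : (2 * k.+1 = (2 * k).+2)%N by lia.
  rewrite /= add0n add1n !factS !natrM mulf_eq0 negb_or => /andP[k1 fk].
  by field; rewrite nat1r k1 fk.
have -> : (n = 2 * k + r)%N by lia.
have E1 : ((2 * k + r).+1 = 2 * k + r.+1)%N by lia.
rewrite E1 !rogers_termE ifF; last by apply/negP; lia.
have -> : (2 * k + r.+2 - 2 * k.+1 = r)%N by lia.
have -> : (2 * k.+1 = (2 * k).+2)%N by lia.
have -> : (2 * k + r + k.+1 = (r + 3 * k).+1)%N by lia.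
have -> : (2 * k + r + k = (r + 3 * k))%N by lia.
rewrite !addSn !factS !natrM !exprS.
have r1 : r.+1%:R != 0 :> rat by rewrite pnatr_eq0.
have r2 : r.+2%:R != 0 :> rat by rewrite pnatr_eq0.
have := fact_neq0 r; have := fact_neq0 (r + 3 * k) => ? ?.
by field; rewrite !nat1r -(natrD _ 2 r); apply/and5P.
Qed.

Definition rogers (n : nat) : nat := \sum_(k < n.+1) rogers_term n k.

(** Padding by zero terms lets the three sums of the recurrence share one range. *)
Lemma rogers_sumE n K : (n < K)%N -> (rogers n)%:R = \sum_(k < K) (rogers_term n k)%:R :> rat.
Proof.
move=> ltnK; rewrite /rogers natr_sum (big_ord_widen K (fun k => (rogers_term n k)%:R)) //.
rewrite [RHS](bigID (fun k : 'I_K => (k < n.+1)%N)) /= [X in _ + X]big1 ?addr0 // => k.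
by rewrite -leqNgt => lt_nk; rewrite rogers_term0 //; lia.
Qed.

Lemma rogers_rec n :
  n.+2%:R ^+ 3 * (rogers n.+2)%:R =
  2 * (2 * n%:R + 3) * (5 * n%:R ^+ 2 + 15 * n%:R + 12) * (rogers n.+1)%:R
  - 64 * n.+1%:R ^+ 3 * (rogers n)%:R :> rat.
Proof.
have lt_n3 : (n < n.+3)%N by lia.
rewrite !(@rogers_sumE _ n.+3) //; apply/eqP.
rewrite -subr_eq0 opprB addrA addrAC !mulr_sumr -sumrB -big_split /=; apply/eqP.
transitivity (\sum_(k < n.+3) (- 192 * (3 * n%:R + 4) * (rogers_cert n k.+1 - rogers_cert n k))).
  by apply: eq_bigr => k _; rewrite -rogers_certE; ring.
rewrite -mulr_sumr -(big_mkord xpredT (fun k => rogers_cert n k.+1 - rogers_cert n k)).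
(* Both ends vanish: k = n + 3 lies beyond the support, and k = 0 is killed by the factor k^4. *)
rewrite telescope_sumr // /rogers_cert ifT; last by lia.
by rewrite muln0 ltn0 expr0n mulr0 subrr mulr0.
Qed.

Lemma domb_rogers n : domb n = rogers n.
Proof.
elim/ltn_ind: n => -[|[|n]] IH.
- by rewrite /domb /rogers !big_ord_recl !big_ord0.
- by rewrite /domb /rogers !big_ord_recl !big_ord0.
apply/eqP; rewrite -(eqr_nat rat); apply/eqP.
apply: (mulfI (_ : n.+2%:R ^+ 3 != 0)); first by rewrite expf_neq0 // pnatr_eq0.
by rewrite domb_rec rogers_rec !IH.
Qed.

(** * Closed form of the weighted sum *)

(** Passing to n + 1 multiplies the sum by 16 and adds one term. On the right the recurrence makes
    the D_n terms, 64 (n+1)^3 D_n, cancel. *)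
Lemma domb_sumE n : 
  6 * \sum_(k < n.+1) (3 * k%:R ^+ 2 + k%:R) * (domb k)%:R * 16 ^+ (n - k) =
  n.+1%:R ^+ 3 * ((domb n.+1)%:R - 4 * (domb n)%:R) :> rat.
Proof.
elim: n => [|n IH].
  by rewrite big_ord1 /domb !big_ord_recl !big_ord0.
rewrite big_ord_recr /= subnn mulrDr.
set S := \sum_(k < n.+1) _ in IH; set T := \sum_(k < n.+1) _.
have -> : T = 16 * S.
  rewrite /T /S mulr_sumr; apply: eq_bigr => i _.
  by rewrite (subSn (leq_ord i)) (exprS _ (n - i)); ring.
rewrite [6 * (16 * S)]mulrCA IH [RHS]mulrBr domb_rec -(natr1 n.+1) -(natr1 n); ring.
Qed.

(** * Catalan numbers and the difference D_n - 4 D_(n-1) *)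

Definition catalan (j : nat) : nat := ('C(2 * j, j) - 'C(2 * j, j.+1))%N.

Lemma mul_catalan j : (j.+1 * catalan j = 'C(2 * j, j))%N.
Proof.
rewrite /catalan mulnBr mul_bin_left (_ : 2 * j - j = j)%N; last by lia.
by rewrite mulSn addnK.
Qed.

(** Serves twice: it gives [catalan j] the parity of C(2j+1,j), and modulo p it absorbs the factor
    2j + 1 coming from C(p-2,2j). *)
Lemma bin_odd_catalan j : ('C(2 * j + 1, j) = (2 * j + 1) * catalan j)%N.
Proof.
apply/eqP; rewrite -(eqn_pmul2l (ltn0Sn j)) mulnCA mul_catalan addn1; apply/eqP.
have := mul_bin_left (2 * j).+1 j.
rewrite (_ : (2 * j).+1 - j = j.+1)%N; last by lia.
by move=> <-; rewrite -mul_bin_diag.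
Qed.

Lemma bin_central_double j : ('C(2 * j.+1, j.+1) = 2 * 'C(2 * j + 1, j))%N.
Proof.
apply/eqP; rewrite -(eqn_pmul2l (ltn0Sn j)) addn1; apply/eqP.
rewrite (_ : 2 * j.+1 = (2 * j).+2)%N; last by lia.
by rewrite -mul_bin_diag /= mulnA; congr (_ * _)%N; lia.
Qed.

(** Shows that C(3j+2,j+1) is even and that its half has the parity of C(3j+3,j+1). *)
Lemma bin3_double j : (3 * 'C(3 * j + 2, j.+1) = 2 * 'C(3 * j.+1, j.+1))%N.
Proof.
have := mul_bin_down (3 * j).+3 j.+1.
rewrite /= (_ : (3 * j).+3 = 3 * j.+1)%N; last by lia.
rewrite (_ : 3 * j.+1 - j.+1 = 2 * j.+1)%N; last by lia.
move=> E; apply/eqP; rewrite -(eqn_pmul2l (ltn0Sn j)) addn2; apply/eqP.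
by rewrite !mulnA -[(j.+1 * 3)%N]mulnC E [(2 * _)%N]mulnC.
Qed.

(* k = j + 1 in C(n-1+k,k) C(n-2,2k-2) Cat(k-1) C(2k,k), with n = m + 2:
   D_n - 4 D_(n-1) is 3 (n-1) times the sum of these times 4^(n-2k). *)
Definition domb_diff_term (m j : nat) : nat :=
  ('C(m + j.+2, j.+1) * 'C(m, 2 * j) * catalan j * 'C(2 * j.+1, j.+1))%N.

(** With n = m + 2 and k = j + 1, Pascal's rule makes the difference C(n-1+k,3k-1) C(2k,k)^2 C(3k,k)
    4^(n-2k); regrouping factorials extracts 3 (n-1). *)
Lemma rogers_term_diff m j :
  rogers_term m.+2 j.+1 =
  (4 * rogers_term m.+1 j.+1 + 3 * m.+1 * (domb_diff_term m j * 4 ^ (m - 2 * j)))%N.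
Proof.
have [lt_mj|/subnKC] := ltnP m (2 * j).
  rewrite !rogers_term0; try lia.
  by rewrite /domb_diff_term ['C(m, _)]bin_small // !(muln0, mul0n).
move: (m - 2 * j)%N => r <-.
have catE : (catalan j)%:R = (2 * j)`!%:R / (j.+1`!%:R * j`!%:R) :> rat.
  have := congr1 (fun x : nat => x%:R : rat) (mul_catalan j).
  rewrite /= bin2_ratE natrM factS natrM => E.
  have j1 : j.+1%:R != 0 :> rat by rewrite pnatr_eq0.
  apply: (mulfI j1); rewrite E.
  by have := fact_neq0 j => fj; field; rewrite nat1r fj j1.
apply/eqP; rewrite -(eqr_nat rat) natrD (natrM _ 4) (natrM _ (3 * _)) (natrM _ 3).
rewrite (natrM _ (domb_diff_term _ _)) natrX; apply/eqP.
have -> k l : (domb_diff_term k l)%:R = 'C(k + l.+2, l.+1)%:R * 'C(k, 2 * l)%:R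
    * (catalan l)%:R * 'C(2 * l.+1, l.+1)%:R :> rat by rewrite !natrM.
rewrite catE (_ : 2 * j + r + j.+2 = j.+1 + (2 * j + r).+1)%N; last by lia.
rewrite !bin_ratE bin2_ratE.
rewrite (_ : (2 * j + r).+2 = 2 * j.+1 + r)%N; last by lia.
rewrite !rogers_termE (_ : r + 3 * j.+1 = (r + 3 * j).+3)%N; last by lia.
rewrite (_ : j.+1 + (2 * j + r).+1 = (r + 3 * j).+2)%N; last by lia.
rewrite (_ : 2 * j.+1 = (2 * j).+2)%N; last by lia.
have fn0 := fact_neq0; have n0 n : n.+1%:R != 0 :> rat by rewrite pnatr_eq0.
(* At r = 0, that is n = 2k, the term at n - 1 is zero. *)
case: r => [|r].
  rewrite rogers_term0; last by lia.
  rewrite ?addn0 add0n !factS !natrM.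
  by field; rewrite -natrM !nat1r !(fn0, n0).
rewrite (_ : (2 * j + r.+1).+1 = 2 * j.+1 + r)%N; last by lia.
rewrite rogers_termE (_ : r + 3 * j.+1 = (r + 3 * j).+3)%N; last by lia.
rewrite (_ : 2 * j.+1 = (2 * j).+2)%N; last by lia.
rewrite (_ : (2 * j).+2 + r = (2 * j + r).+2)%N; last by lia.
rewrite addnS !addSn !factS !natrM !exprS.
by field; rewrite -!natrM -!natrD !nat1r !(fn0, n0).
Qed.

Lemma domb_diff m :
  domb m.+2 = (4 * domb m.+1 +
    3 * m.+1 * \sum_(j < m.+2) domb_diff_term m j * 4 ^ (m - 2 * j))%N.
Proof.
rewrite !domb_rogers; apply/eqP; rewrite -(eqr_nat rat) natrD !natrM; apply/eqP.
rewrite (@rogers_sumE m.+1 m.+3) ?(@rogers_sumE m.+2 m.+3) // !(big_ord_recl m.+2).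
rewrite /= mulrDr !mulr_sumr natr_sum mulr_sumr -addrA; congr (_ + _).
  (* The terms k = 0 are pure powers of 4 and contribute nothing to the difference. *)
  by rewrite /rogers_term !muln0 !bin0 !mul1n !subn0 expnS natrM.
rewrite -big_split /=; apply: eq_bigr => j _.
by rewrite /bump add1n rogers_term_diff natrD !natrM.
Qed.

(** * Parity of binomial coefficients *)

(** Lucas' theorem modulo 2 for an even upper index. Pascal's rule applied twice involves lower
    indices of both parities, hence the joint induction. *)
Lemma odd_bin_double a b :
  odd 'C(2 * a, 2 * b) = odd 'C(a, b) /\ odd 'C(2 * a, (2 * b).+1) = false.
Proof.
elim: a b => [|a IH] b.
  by rewrite muln0 !bin0n; split; case: b.
rewrite mulnS !addSn add0n; split.
  case: b => [|b]; first by rewrite muln0 !bin0.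
  have [E1 E2] := IH b; have [E3 _] := IH b.+1.
  move: E3; rewrite mulnS !addSn add0n => E3.
  by rewrite !binS !oddD E1 E2 E3; case: odd; case: odd.
case: b => [|b]; first by rewrite muln0 bin1 /= oddM.
have [_ E2] := IH b; have [E3 E4] := IH b.+1.
move: E3 E4; rewrite mulnS !addSn add0n => E3 E4.
by rewrite !binS !oddD E2 E3 E4; case: odd; case: odd.
Qed.

Lemma odd_bin_central b : odd 'C(2 * b, b) = (b == 0)%N.
Proof. by case: b => // b; rewrite bin_central_double oddM. Qed.

(** By [odd_bin_double], an even k > 0 reduces to an even central binomial, and k = 2b + 1 reduces
    to b, where k + 1 = 2 (b + 1). *)
Lemma odd_bin_near_central k :
  odd 'C(2 * k + 1, k) <-> exists m, k.+1 = (2 ^ m)%N.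
Proof.
elim/ltn_ind: k => k IH; rewrite addn1.
have [b [Ek|Ek]] : exists b, k = (2 * b)%N \/ k = (2 * b).+1.
  by exists k./2; lia.
- have -> : odd 'C((2 * k).+1, k) = (k == 0)%N.
    rewrite Ek; case: b {Ek} => // b.
    have -> : (2 * b.+1 = (2 * b).+2)%N by lia.
    rewrite binS oddD.
    have [E1 _] := odd_bin_double (2 * b).+2 b.+1; have [_ E2] := odd_bin_double (2 * b).+2 b.
    move: E1; have -> : (2 * b.+1 = (2 * b).+2)%N by lia.
    by move=> ->; rewrite E2 addbF -add2n -mulnS odd_bin_central.
  split=> [/eqP->|[[|m] Em]]; first by exists 0%N.
    by case: k Em {IH Ek}.
  by move: Em; rewrite expnS; lia.
- have -> : odd 'C((2 * k).+1, k) = odd 'C(2 * b + 1, b).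
    rewrite Ek binS oddD.
    have [_ ->] := odd_bin_double (2 * b).+1 b; have [-> _] := odd_bin_double (2 * b).+1 b.
    by rewrite addn1.
  rewrite IH; last by lia.
  split=> -[m Em]; first by exists m.+1; rewrite expnS -Em; lia.
  by case: m Em => [|m]; rewrite ?expnS => Em; [lia | exists m; lia].
Qed.

Lemma odd_bin3_pow2 m : odd 'C(3 * 2 ^ m, 2 ^ m).
Proof.
elim: m => [|m IH] //.
by rewrite expnS mulnCA; have [-> _] := odd_bin_double (3 * 2 ^ m) (2 ^ m).
Qed.

(** * The quotient a_n: integrality and parity *)

(** A quarter of [domb_diff_term m j * 4 ^ (m - 2 * j)]. For 2j < m the 4 is taken from the power
    and C(2j+2,j+1) leaves a factor 2; for 2j = m it comes from the even numbers C(2j+2,j+1) and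
    C(3j+2,j+1). *)
Definition domb_quot_term (m j : nat) : nat :=
  if (2 * j < m)%N then
    (2 * ('C(m + j.+2, j.+1) * 'C(m, 2 * j) * catalan j * 'C(2 * j + 1, j)
          * 4 ^ (m - 2 * j).-1))%N
  else if (2 * j == m)%N then ('C(3 * j + 2, j.+1)./2 * catalan j * 'C(2 * j + 1, j))%N
  else 0%N.

Lemma domb_quot_termE m j :
  (domb_diff_term m j * 4 ^ (m - 2 * j) = 4 * domb_quot_term m j)%N.
Proof.
rewrite /domb_diff_term /domb_quot_term bin_central_double.
case: ltngtP => [lt_jm|lt_mj|<-].
- by rewrite -[in LHS](prednK (_ : 0 < m - 2 * j)%N) ?subn_gt0 // expnS; ring.
- by rewrite ['C(m, _)]bin_small // !(muln0, mul0n).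
- rewrite subnn binn (_ : 2 * j + j.+2 = 3 * j + 2)%N; last by lia.
  have : (2 * ('C(3 * j + 2, j.+1))./2 = 'C(3 * j + 2, j.+1))%N by have := bin3_double j; lia.
  move=> E; rewrite -{1}E; ring.
Qed.

(** The number a_n of the theorem, at n = m + 2. *)
Definition domb_quot (m : nat) : nat := \sum_(j < m.+2) domb_quot_term m j.

(** Only the term 2j = m can be odd. Two of its factors have the parity of C(2j+1,j), odd iff j + 1
    is a power of two; the remaining factor is then odd too, and m + 2 = 2 (j + 1). *)
Lemma odd_domb_quot m : odd (domb_quot m) <-> exists e, m.+2 = (2 ^ e)%N.
Proof.
have oddE : odd (domb_quot m) = ~~ odd m && odd (domb_quot_term m m./2).
  rewrite /domb_quot.
  have lt_m : (m./2 < m.+2)%N by lia.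
  rewrite (bigD1 (Ordinal lt_m)) //= oddD.
  have -> : odd (\sum_(i < m.+2 | i != Ordinal lt_m) domb_quot_term m i) = false.
    apply: (big_ind (fun s => odd s = false)) => // [x y|i]; first by rewrite oddD => -> ->.
    rewrite -val_eqE /= /domb_quot_term => ne_i; case: ltngtP => // [_|Ei].
      by rewrite oddM.
    by case/eqP: ne_i; lia.
  rewrite addbF; case: (boolP (odd m)) => //= odd_m.
  by rewrite /domb_quot_term ifT ?oddM //; lia.
rewrite oddE; case: (boolP (odd m)) => odd_m /=.
  by split=> // -[[|e]]; rewrite ?expnS; lia.
pose j := m./2; have Em : (m = 2 * j)%N by rewrite /j; lia.
rewrite /domb_quot_term -/j Em ltnn eqxx !oddM.
have -> : odd (catalan j) = odd 'C(2 * j + 1, j).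
  by rewrite bin_odd_catalan oddM addn1 mul2n /= odd_double.
have -> : odd ('C(3 * j + 2, j.+1))./2 = odd 'C(3 * j.+1, j.+1) by have := bin3_double j; lia.
have [odd_c odd_c'] := odd_bin_near_central j.
split=> [/andP[/andP[_ /odd_c[e Ee]] _]|[e Ee]].
  by exists e.+1; rewrite expnS -Ee; lia.
have [e' Ee'] : exists e', j.+1 = (2 ^ e')%N.
  by case: e Ee => [|e]; rewrite ?expnS => Ee; [lia | exists e; lia].
by rewrite odd_c' ?andbT; [rewrite Ee' odd_bin3_pow2 | exists e'].
Qed.

Lemma domb_quotD m : domb m.+2 = (4 * domb m.+1 + 12 * m.+1 * domb_quot m)%N.
Proof.
rewrite domb_diff; congr (_ + _)%N.
under eq_bigr => j _ do rewrite domb_quot_termE.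
rewrite -big_distrr /= /domb_quot; ring.
Qed.

Lemma domb_sum_quot m :
  \sum_(k < m.+2) (3 * k%:R ^+ 2 + k%:R) * (domb k)%:R * 16 ^+ (m.+1 - k) =
  2 * m.+2%:R ^+ 3 * m.+1%:R * (domb_quot m)%:R :> rat.
Proof.
apply: (mulfI (_ : 6 != 0)) => //.
by rewrite domb_sumE domb_quotD natrD !natrM; ring.
Qed.

Lemma domb_quotientE m : domb_quotient m.+2 = (domb_quot m)%:R.
Proof.
rewrite /domb_quotient subn1 /=.
rewrite domb_sum_quot.
have m1 : m.+1%:R != 0 :> rat by rewrite pnatr_eq0.
have m2 : m.+2%:R != 0 :> rat by rewrite pnatr_eq0.
have -> : m.+2%:R - 1 = m.+1%:R :> rat by rewrite -(natr1 m.+1) addrK.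
by field; rewrite !nat1r -(natrD _ 2 m) m1 m2.
Qed.

(** * Binomial identities for the reduction modulo p *)

(** Partial sums are stated because they allow induction on M; what is needed later is that the sum
    is zero once M > n. *)
Lemma alternating_bin_sum (R : pzRingType) n M :
  \sum_(k < M.+1) (-1) ^+ k * ('C(n.+1, k) * 'C(n + k, k))%:R
  = (-1) ^+ M * ('C(n, M) * 'C(n.+1 + M, M))%:R :> R.
Proof.
elim: M => [|M IH]; first by rewrite big_ord1 !bin0.
rewrite big_ord_recr /= {}IH.
have E : ('C(n.+1, M.+1) * 'C(n + M.+1, M.+1) =
          'C(n, M) * 'C(n.+1 + M, M) + 'C(n, M.+1) * 'C(n.+1 + M.+1, M.+1))%N.
  have E1 : (M.+1 * 'C(n + M.+1, M.+1) = n.+1 * 'C(n + M.+1, M))%N.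
    by rewrite mul_bin_left; congr (_ * _)%N; lia.
  have E2 := mul_bin_left n M.
  rewrite (addSn n M.+1) (addSnnS n M) (binS n M) (binS (n + M.+1)).
  move: E1 E2; set a := 'C(n, M); set b := 'C(n, M.+1).
  set c := 'C(n + M.+1, M); set d := 'C(n + M.+1, M.+1) => E1 E2.
  suff : (a * d = a * c + b * c)%N by lia.
  apply/eqP; rewrite -(eqn_pmul2l (ltn0Sn M)); apply/eqP.
  have [le_Mn|lt_nM] := leqP M n; last first.
    by rewrite /a /b (bin_small lt_nM) (bin_small (leqW lt_nM)).
  rewrite mulnCA E1 mulnDr [(M.+1 * (b * c))%N]mulnA E2.
  have : (n = M + (n - M))%N by lia.
  move: (n - M)%N => r ->; ring.
by rewrite E natrD mulrDr exprS !mulN1r !mulNr addrA subrr add0r.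
Qed.

(** The increment in n of C(n,k) C(n+k,k) carries a factor k, which cancels the 1/k in the sum of
    [pchar_bin_apery_sum]. *)
Lemma bin_prod_diff n k :
  (n.+1 * ('C(n.+1, k) * 'C(n.+1 + k, k)) =
   n.+1 * ('C(n, k) * 'C(n + k, k)) + 2 * k * ('C(n.+1, k) * 'C(n + k, k)))%N.
Proof.
have E1 : (n.+1 * 'C(n.+1 + k, k) = (n.+1 + k) * 'C(n + k, k))%N.
  by have := mul_bin_down (n.+1 + k) k; rewrite addnK addSn => ->.
have E2 := mul_bin_down n.+1 k.
have [le_kn|lt_nk] := leqP k n.+1; last first.
  by rewrite (bin_small lt_nk) (bin_small (ltnW lt_nk)) mul0n !muln0.
rewrite mulnCA E1 [in RHS]mulnA E2.
have : (n.+1 = k + (n.+1 - k))%N by lia.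
move: (n.+1 - k)%N => r ->; ring.
Qed.

Lemma sum_inner_bin n : (2 ^ n.+1 = 2 + \sum_(j < n) 'C(n.+1, j.+1))%N.
Proof.
have := expnDn 1 1 n.+1; rewrite big_ord_recl big_ord_recr /= bin0 binn !exp1n.
under eq_bigr => j _ do rewrite !exp1n !muln1.
by rewrite addn1 => ->; rewrite addnCA addnC -addnA.
Qed.

(** * Computations in characteristic p *)

Section Modp.
Context (F : fieldType) (p : nat) (pcharFp : p \in [pchar F]).
Let p_pr : prime p := pcharf_prime pcharFp.

Lemma natr_pchar_neq0 n : (0 < n < p)%N -> n%:R != 0 :> F.
Proof.
case/andP=> n_gt0 lt_np; rewrite -(dvdn_pcharf pcharFp).
by rewrite gtnNdvd.
Qed.

Lemma pchar_natr0 : p%:R = 0 :> F.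
Proof. exact: pcharf0. Qed.

(** Induction on n with K fixed: the increment is 2/(n+1) times an alternating sum that equals -1,
    being a zero sum without its term k = 0. K < p keeps the denominators invertible. *)
Lemma pchar_bin_apery_sum n K : (n <= K < p)%N ->
  \sum_(j < K) (-1) ^+ j.+1 * ('C(n, j.+1) * 'C(n + j.+1, j.+1))%:R / j.+1%:R
  = - 2 * \sum_(j < n) j.+1%:R^-1 :> F.
Proof.
case/andP=> le_nK lt_Kp; elim: n le_nK => [|n IH] le_nK.
  by rewrite big_ord0 mulr0 big1 // => j _; rewrite bin0n /= mul0n mulr0 mul0r.
rewrite big_ord_recr /= mulrDr -{}IH; last exact: ltnW.
have n1 : n.+1%:R != 0 :> F by rewrite natr_pchar_neq0 //; lia.
have E := alternating_bin_sum F n K.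
rewrite big_ord_recl /= !bin0 mulr1 bin_small // mul0n mulr0 in E.
have {}E : \sum_(j < K) (-1) ^+ j.+1 * ('C(n.+1, j.+1) * 'C(n + j.+1, j.+1))%:R = -1 :> F.
  by apply/eqP; rewrite -addr_eq0 addrC; apply/eqP.
apply: (mulfI n1); rewrite mulrDr mulrCA mulfV // mulr1.
have -> : -2 = 2 * -1 :> F by rewrite mulrN1.
rewrite -[in X in _ = _ + X]E !mulr_sumr -big_split /=; apply: eq_bigr => j _.
have j1 : j.+1%:R != 0 :> F by rewrite natr_pchar_neq0 //; have := ltn_ord j; lia.
have /(congr1 (fun x : nat => x%:R : F)) := bin_prod_diff n j.+1.
rewrite natrD (natrM _ n.+1) (natrM _ n.+1 (_ * _)) (natrM _ (2 * _)) (natrM _ 2).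
set a := (_ * _)%:R; set b := (_ * _)%:R; set c := (_ * _)%:R => E1.
transitivity ((-1) ^+ j.+1 * (n.+1%:R * a) / j.+1%:R); first by ring.
by rewrite E1; field; rewrite nat1r.
Qed.

(** In F both h and -h-1 equal -1/2, so (-1)^k C(h,k) C(h+k,k) = C(h,k) C(-h-1,k) becomes
    C(-1/2,k)^2, where C(-1/2,k) = C(2k,k) / (-4)^k. *)
Lemma pchar_central_bin h k : (p = 2 * h + 1)%N -> (k <= h)%N ->
  'C(2 * k, k)%:R ^+ 2 = 16 ^+ k * ((-1) ^+ k * ('C(h, k) * 'C(h + k, k))%:R) :> F.
Proof.
move=> Ep; elim: k => [|k IH] le_kh; first by rewrite !bin0 !expr0 !mul1r expr1n.
have k1 : k.+1%:R != 0 :> F by rewrite natr_pchar_neq0 //; lia.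
have E1 : (k.+1 * 'C(2 * k.+1, k.+1) = 2 * (2 * k + 1) * 'C(2 * k, k))%N.
  rewrite bin_central_double bin_odd_catalan -(mul_catalan k); ring.
have E2 := mul_bin_left h k.
have E3 : (k.+1 * 'C(h + k.+1, k.+1) = (h + k.+1) * 'C(h + k, k))%N.
  by rewrite -mul_bin_diag addnS.
have h2 : 2 * h%:R = -1 :> F.
  by apply/eqP; rewrite -addr_eq0 -natrM natr1 -addn1 -Ep pchar_natr0.
have key : (2 * (2 * k + 1))%:R ^+ 2 = 16 * - ((h%:R - k%:R) * (h%:R + k.+1%:R)) :> F.
  transitivity (4 * ((2 * k%:R) + 1) ^+ 2 : F); first by ring.
  transitivity (- 4 * ((2 * h%:R) - 2 * k%:R) * ((2 * h%:R) + 2 * k%:R + 2) : F); last by ring.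
  rewrite h2; ring.
apply: (mulfI (_ : k.+1%:R ^+ 2 != 0)); first by rewrite expf_neq0.
rewrite -exprMn -natrM E1 natrM exprMn IH 1?ltnW // key.
transitivity (16 ^+ k.+1 * ((-1) ^+ k.+1 *
    ((k.+1 * 'C(h, k.+1))%:R * (k.+1 * 'C(h + k.+1, k.+1))%:R)) : F); last first.
  by rewrite !natrM; ring.
rewrite E2 E3 (natrM _ (h - k)) (natrM _ (h + _)) natrB 1?ltnW // (natrD _ h) natrM !exprS.
ring.
Qed.

Lemma pchar_bin_shift j : (j < p)%N -> 'C(p + j, j)%:R = 1 :> F.
Proof.
elim: j => [|j IH] lt_jp; first by rewrite bin0.
have j1 : j.+1%:R != 0 :> F by rewrite natr_pchar_neq0.
apply: (mulfI j1); rewrite -natrM -mul_bin_diag addnS natrM IH 1?ltnW //.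
by rewrite -addnS natrD pchar_natr0 add0r.
Qed.

Lemma pchar_bin_p1 i : (i < p)%N -> 'C(p.-1, i)%:R = (-1) ^+ i :> F.
Proof.
elim: i => [|i IH] lt_ip; first by rewrite bin0.
have i1 : i.+1%:R != 0 :> F by rewrite natr_pchar_neq0.
apply: (mulfI i1); rewrite -natrM mul_bin_left natrM IH 1?ltnW //.
have -> : (p.-1 - i = p - i.+1)%N by lia.
by rewrite natrB 1?ltnW // pchar_natr0 exprS; ring.
Qed.

Lemma pchar_bin_p2 i : (i.+1 < p)%N -> 'C(p.-2, i)%:R = (-1) ^+ i * i.+1%:R :> F.
Proof.
elim: i => [|i IH] lt_ip; first by rewrite bin0 mulr1.
have i1 : i.+1%:R != 0 :> F by rewrite natr_pchar_neq0 //; lia.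
apply: (mulfI i1); rewrite -natrM mul_bin_left natrM IH 1?ltnW //.
have -> : (p.-2 - i = p - i.+2)%N by lia.
by rewrite natrB 1?ltnW // pchar_natr0 exprS; ring.
Qed.

(** Twice the sum of the reciprocals of even numbers up to 2h is H_h. *)
Lemma pchar_alternating_harmonic h : (2 * h < p)%N ->
  \sum_(j < 2 * h) (-1) ^+ j / j.+1%:R =
  \sum_(j < 2 * h) j.+1%:R^-1 - \sum_(j < h) j.+1%:R^-1 :> F.
Proof.
elim: h => [|h IH] lt_hp; first by rewrite muln0 !big_ord0 subr0.
have E : (2 * h.+1 = (2 * h).+2)%N by lia.
rewrite E !big_ord_recr /= IH; last by lia.
have h1 : h.+1%:R != 0 :> F by rewrite natr_pchar_neq0 //; lia.
have h2 : (2 * h).+1%:R != 0 :> F by rewrite natr_pchar_neq0 //; lia.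
have two : 2%:R != 0 :> F by rewrite natr_pchar_neq0 //; lia.
rewrite -E natrM exprS exprM sqrrN !expr1n.
set a := \sum_(_ < _) _; set b := \sum_(_ < _) _.
by field; rewrite -natrM !nat1r h1 two h2.
Qed.

Lemma pchar_harmonic : (2 < p)%N -> \sum_(j < p.-1) j.+1%:R^-1 = 0 :> F.
Proof.
move=> p_gt2; have two : 2%:R != 0 :> F by rewrite natr_pchar_neq0.
apply: (mulfI two); rewrite mulr0 mulr_natl mulr2n.
(* The reciprocals of i and p - i cancel. *)
rewrite {1}(reindex_inj rev_ord_inj) -big_split big1 //= => j _.
have -> : (p.-1 - j.+1).+1 = (p - j.+1)%N by have := ltn_ord j; lia.
rewrite natrB; last by have := ltn_ord j; lia.
by rewrite pchar_natr0 sub0r invrN addNr.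
Qed.

(** 2pq = 2^p - 2 is the sum of the inner C(p,i), and C(p,i)/p = (-1)^(i-1)/i in F. The alternating
    sum is then H_(p-1) - H_h with H_(p-1) = 0. *)
Lemma pchar_fermat_quotient h q : (p = 2 * h + 1)%N -> (0 < h)%N -> (2 ^ p.-1 = p * q + 1)%N ->
  2 * q%:R = - \sum_(j < h) j.+1%:R^-1 :> F.
Proof.
move=> Ep h_gt0 Eq.
have p1E : (p.-1 = 2 * h)%N by lia.
have Hh : \sum_(j < 2 * h) (-1) ^+ j / j.+1%:R = - \sum_(j < h) j.+1%:R^-1 :> F.
  by rewrite pchar_alternating_harmonic -?p1E ?pchar_harmonic ?sub0r //; lia.
pose f (j : nat) := ('C(p, j.+1) %/ p)%N.
have fE j : (j < p.-1)%N -> 'C(p, j.+1) = (p * f j)%N.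
  by move=> ?; rewrite mulnC divnK // prime_dvd_bin //; lia.
have : (2 * q = \sum_(j < p.-1) f j)%N.
  apply/eqP; rewrite -(eqn_pmul2l (prime_gt0 p_pr)); apply/eqP.
  have := sum_inner_bin p.-1; rewrite prednK ?prime_gt0 //.
  under eq_bigr => j _ do rewrite fE //.
  rewrite -big_distrr -{1}(prednK (prime_gt0 p_pr)) expnS Eq /=; nia.
move=> /(congr1 (fun x : nat => x%:R : F)); rewrite natrM => ->.
rewrite -Hh -p1E natr_sum; apply: eq_bigr => j _.
have j1 : j.+1%:R != 0 :> F by rewrite natr_pchar_neq0 //; have := ltn_ord j; lia.
apply: (mulfI j1); rewrite mulrCA mulfV // mulr1 -pchar_bin_p1; last by have := ltn_ord j; lia.
rewrite -natrM; congr (_%:R).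
apply/eqP; rewrite -(eqn_pmul2l (prime_gt0 p_pr)) mulnCA -fE //.
by rewrite -mul_bin_diag.
Qed.

(** With k = j + 1, C(p+j,k) is p times a number equal to 1/k in F, and 4^(p-1) = 1 turns the power
    of 4 into 1/16^k. The sum of C(2k,k)^2 / (2k 16^k) is then evaluated by [pchar_central_bin] and
    [pchar_bin_apery_sum]. *)
Lemma domb_quot_modp h q : (p = 2 * h + 1)%N -> (0 < h)%N -> (2 ^ p.-1 = p * q + 1)%N ->
  exists2 E : nat, domb_quot p.-2 = (p * E)%N & E%:R = 2 * q%:R :> F.
Proof.
move=> Ep h_gt0 Eq.
pose e (j : nat) := ('C(p + j, j.+1) %/ p)%N.
have eE j : (j.+1 < p)%N -> 'C(p + j, j.+1) = (p * e j)%N.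
  move=> lt_jp; rewrite mulnC divnK //.
  have : (p %| j.+1 * 'C(p + j, j.+1))%N by rewrite mul_bin_left addnK dvdn_mulr.
  by rewrite Gauss_dvdr // prime_coprime // gtnNdvd.
pose t (j : nat) := (2 * (e j * 'C(p.-2, 2 * j) * catalan j * 'C(2 * j + 1, j)
                          * 4 ^ (p.-2 - 2 * j).-1))%N.
exists (\sum_(j < h) t j)%N.
  rewrite /domb_quot big_distrr /=.
  rewrite (big_ord_widen p (fun j => p * t j)%N); last by lia.
  rewrite (_ : p.-2.+2 = p)%N; last by lia.
  rewrite [RHS]big_mkcond /=; apply: eq_bigr => j _; rewrite /domb_quot_term.
  case: ifP => [lt_jp|ge_jp].
    rewrite ifT; last by lia.
    rewrite (_ : p.-2 + j.+2 = p + j)%N; last by lia.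
    rewrite eE; last by lia.
    rewrite /t; ring.
  (* The case 2j = p - 2 is excluded because p is odd. *)
  rewrite ifF; last by lia.
  by rewrite ifF //; lia.
have two : 2%:R != 0 :> F by rewrite natr_pchar_neq0 //; lia.
have four : 4%:R != 0 :> F by rewrite (natrM _ 2 2) mulf_neq0.
have fermat4 : 4 ^+ p.-1 = 1 :> F.
  by rewrite (natrM _ 2 2) exprMn -natrX Eq natrD natrM pchar_natr0 mul0r add0r mulr1.
rewrite (pchar_fermat_quotient _ _ Ep h_gt0 Eq).
apply: (mulfI two); rewrite mulrN -mulNr -(@pchar_bin_apery_sum h h); last by lia.
rewrite natr_sum mulr_sumr; apply: eq_bigr => j _.
have lt_jh := ltn_ord j.
have j1 : j.+1%:R != 0 :> F by rewrite natr_pchar_neq0 //; lia.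
have e1 : j.+1%:R * (e j)%:R = 1 :> F.
  rewrite -[RHS](@pchar_bin_shift j) -?natrM; last by lia.
  congr (_%:R); apply/eqP; rewrite -(eqn_pmul2l (prime_gt0 p_pr)) mulnCA -eE; last by lia.
  by rewrite mul_bin_left addnK.
apply: (mulfI j1); rewrite [RHS]mulrCA mulfV // mulr1.
have f16 : 16 ^+ j.+1 != 0 :> F.
  by rewrite expf_neq0 // (natrM _ 4 4) mulf_neq0.
apply: (mulfI f16); rewrite -(@pchar_central_bin h) // bin_central_double.
rewrite /t !natrM (@pchar_bin_p2 (2 * j)); last by lia.
rewrite exprM sqrrN !expr1n mul1r natrX -addn1.
transitivity (4 * (j.+1%:R * (e j)%:R) * ((2 * j + 1)%:R * (catalan j)%:R) * 'C(2 * j + 1, j)%:R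
   * (16 ^+ j.+1 * 4 ^+ (p.-2 - 2 * j).-1) : F); first by ring.
rewrite e1 -natrM -bin_odd_catalan.
have -> : 16 ^+ j.+1 * 4 ^+ (p.-2 - 2 * j).-1 = 1 :> F.
  rewrite (natrM _ 4 4) -expr2 -exprM -exprD.
  by rewrite (_ : (2 * j.+1 + (p.-2 - 2 * j).-1)%N = p.-1) //; lia.
ring.
Qed.

End Modp.

(** * The supercongruence *)

Lemma p_integral_frac (p d : nat) (a : int) :
  (0 < d)%N -> coprime p d -> p_integral p (a%:~R / d%:R).
Proof.
move=> d_gt0 co_pd; rewrite /p_integral; set x := _ / _.
have d0 : d%:R != 0 :> rat by rewrite pnatr_eq0 -lt0n.
apply: coprime_dvdr co_pd.
have : numq x * d%:Z = a * denq x.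
  apply/eqP; rewrite -(eqr_int rat) !intrM numqE mulrAC /x.
  by rewrite divfK.
move=> E.
have : (denq x %| numq x * d%:Z)%Z by rewrite E dvdz_mull.
by rewrite Gauss_dvdzr // coprimez_sym; exact: coprime_num_den.
Qed.

Lemma domb_supercongruence (p : nat) : prime p -> (3 < p)%N ->
  rat_eqmod p 5
       (\sum_(k < p) (3 * k%:R ^+ 2 + k%:R) / 16 ^+ k * (domb k)%:R)
       (- 4 * p%:R ^+ 4 * fermat_quotient p 2).
Proof.
move=> p_pr p_gt3.
have p_odd : odd p by case: (even_prime p_pr) => // p2; rewrite p2 in p_gt3.
pose h := p./2; have Ep : (p = 2 * h + 1)%N by rewrite /h; lia.
have h_gt0 : (0 < h)%N by lia.
have co2 : coprime p 2 by rewrite coprimen2.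
have fermat : (p %| 2 ^ p.-1 - 1)%N.
  rewrite -eqn_mod_dvd ?expn_gt0 // -totient_prime //.
  by apply/eqP/Euler_exp_totient; rewrite coprime_sym.
case/dvdnP: fermat => q Eq.
have {}Eq : (2 ^ p.-1 = p * q + 1)%N by have := expn_gt0 2 p.-1; rewrite mulnC; lia.
have [E domb_quotE Emodp] := domb_quot_modp 'F_p p (pchar_Fp p_pr) h q Ep h_gt0 Eq.
(* The difference of the two sides is p^4 N / 16^(p-1). Modulo p, N is -2E + 4q = 0 since E = 2q,
   which gives the fifth factor p. *)
pose N := (2 * p.-1 * E + 4 * q * 16 ^ p.-1)%N.
have /dvdnP[M EM] : (p %| N)%N.
  rewrite (dvdn_pcharf (pchar_Fp p_pr)) /N natrD !natrM natrX Emodp.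
  have -> : p.-1%:R = -1 :> 'F_p.
    by apply/eqP; rewrite -addr_eq0 natr1 prednK ?prime_gt0 // pcharf0 ?pchar_Fp.
  have -> : 16 ^+ p.-1 = 1 :> 'F_p.
    rewrite -[16]/((2 ^ 4)%:R) -natrX expnAC natrX Eq natrD natrM.
    by rewrite (pcharf0 (pchar_Fp p_pr)) mul0r add0r expr1n.
  by apply/eqP; ring.
have p0 : p%:R != 0 :> rat by rewrite pnatr_eq0 -lt0n prime_gt0.
have s0 : 16 ^+ p.-1 != 0 :> rat by rewrite expf_neq0.
have fqE : fermat_quotient p 2 = q%:R.
  rewrite /fermat_quotient subn1 -natrX Eq natrD natrM addrK mulrC mulKf //.
have sumE : \sum_(k < p) (3 * k%:R ^+ 2 + k%:R) / 16 ^+ k * (domb k)%:R =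
   (2 * p%:R ^+ 3 * p.-1%:R * (p * E)%:R) / 16 ^+ p.-1 :> rat.
  have := domb_sum_quot p.-2; rewrite domb_quotE !prednK //; try lia.
  move=> <-; rewrite mulr_suml; apply: eq_bigr => k _.
  have k0 : 16 ^+ k != 0 :> rat by rewrite expf_neq0.
  have k1 : 16 ^+ (p.-1 - k) != 0 :> rat by rewrite expf_neq0.
  have -> : 16 ^+ p.-1 = 16 ^+ (p.-1 - k) * 16 ^+ k :> rat.
    by rewrite -exprD subnK //; have := ltn_ord k; lia.
  field; exact/andP.
rewrite /rat_eqmod sumE fqE.
have -> : (2 * p%:R ^+ 3 * p.-1%:R * (p * E)%:R / 16 ^+ p.-1 - (-4) * p%:R ^+ 4 * q%:R) / p%:R ^+ 5
   = M%:Z%:~R / (16 ^ p.-1)%:R :> rat.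
  have -> : M%:Z%:~R = N%:R / p%:R :> rat by rewrite EM natrM mulfK.
  rewrite /N natrD !natrM natrX; field. exact/andP.
apply: p_integral_frac; first by rewrite expn_gt0.
by apply: coprimeXr; exact: (@coprimeXr 4 p 2 co2).
Qed.

Theorem theorem1p6 :
  (forall n : nat, (1 < n)%N ->
     exists z : int, domb_quotient n = z%:~R
       /\ (odd `|z|%N <-> exists m : nat, n = (2 ^ m)%N))
  /\
  (forall p : nat, prime p -> (3 < p)%N ->
     rat_eqmod p 5
       (\sum_(k < p) (3 * k%:R ^+ 2 + k%:R) / 16 ^+ k * (domb k)%:R)
       (- 4 * p%:R ^+ 4 * fermat_quotient p 2)).
Proof.
split=> [[|[|m]] // _|]; last exact: domb_supercongruence.
by exists (domb_quot m)%:Z; rewrite domb_quotientE; split=> //; exact: odd_domb_quot.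
Qed.
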